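(* Let $k$ be an algebraically closed field of characteristic $p>0$ and let $X$ be a scheme, separated and of finite type over $k$. Assume that $X$ is Frobenius split by a splitting $\sigma\in \operatorname{Hom}_{\mathcal{O}_X}(F_*\mathcal{O}_X,\mathcal{O}_X)$, where $F:X\to X$ is the absolute Frobenius morphism. Then there are only finitely many closed subschemes of $X$ which are compatibly split under $\sigma$.
   Context: The absolute Frobenius morphism $F:X\to X$ is the identity on the underlying topological space, and $F^{\#}:\mathcal{O}_X\to F_*\mathcal{O}_X$ is the $p$-th power map $f\mapsto f^p$. A splitting (Frobenius splitting) of $X$ is an $\mathcal{O}_X$-linear map $\sigma:F_*\mathcal{O}_X\to\mathcal{O}_X$ such that the composition $\sigma\circ F^{\#}$ is the identity of $\mathcal{O}_X$; equivalently, $\sigma$ is an additive map $\mathcal{O}_X\to\mathcal{O}_X$ with $\sigma(f^p g)=f\,\sigma(g)$ for all local sections $f,g$ and $\sigma(1)=1$. $X$ is Frobenius split by $\sigma$ if $\sigma$ is such a splitting. A closed subscheme $Y\subset X$ with ideal sheaf $\mathcal{I}_Y$ is compatibly split (under $\sigma$) if $\sigma(F_*\mathcal{I}_Y)\subset \mathcal{I}_Y$. *)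

(* Defs.v *)
From HB Require Import structures.
From mathcomp Require Import all_boot all_order all_algebra.
From mathcomp Require Import all_classical.
From mathcomp Require Import topology.

Set Implicit Arguments.
Unset Strict Implicit.
Unset Printing Implicit Defensive.

Import GRing.Theory.
Local Open Scope classical_set_scope.
Local Open Scope ring_scope.

(** * Prime spectrum *)

(* All rings of sections are [comPzRingType]s: the ring of sections over the
   empty set is the zero ring, which mathcomp's [nzRingType]s (and hence its
   [prime_idealr]) exclude. *)
Record is_prime (A : comPzRingType) (P : set A) : Prop := IsPrime {
  prime0 : P 0;
  primeD : forall a b, P a -> P b -> P (a + b);
  primeMl : forall a b, P b -> P (a * b);
  prime1 : ~ P 1;
  primeM : forall a b, P (a * b) -> P a \/ P b }.

Record spec (A : comPzRingType) :=
  Spec { spec_ideal : set A; spec_prime : is_prime spec_ideal }.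

HB.instance Definition _ (A : comPzRingType) := gen_eqMixin (spec A).
HB.instance Definition _ (A : comPzRingType) := gen_choiceMixin (spec A).

Definition basic_open (A : comPzRingType) (f : A) : set (spec A) :=
  [set P : spec A | ~ spec_ideal P f].

(* [\bigcup_(f in E) basic_open f] is the complement of V(E). *)
Definition zariski_open (A : comPzRingType) : set_system (spec A) :=
  [set U | exists E : set A, U = \bigcup_(f in E) basic_open f].

Lemma zariski_openT (A : comPzRingType) : @zariski_open A setT.
Proof.
exists [set 1]; apply/seteqP; split=> // P _.
by exists 1 => //; exact: prime1 (spec_prime P).
Qed.

Lemma zariski_openI (A : comPzRingType) : setI_closed (@zariski_open A).
Proof.
move=> _ _ [E ->] [F ->].
exists [set h | exists f g, [/\ E f, F g & h = f * g]].
apply/seteqP; split=> P.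
  move=> [[f Ef Pf] [g Fg Pg]]; exists (f * g); first by exists f, g.
  by case/(primeM (spec_prime P)).
move=> [_ [f [g [Ef Fg ->]]] Pfg]; split.
  exists f => // Pf; apply: Pfg; rewrite mulrC.
  exact: primeMl (spec_prime P) _ _ Pf.
by exists g => // Pg; apply: Pfg; exact: primeMl (spec_prime P) _ _ Pg.
Qed.

Lemma zariski_open_bigcup (A : comPzRingType) (I : Type)
    (f : I -> set (spec A)) :
  (forall i, zariski_open (f i)) -> zariski_open (\bigcup_i f i).
Proof.
move=> fop; exists [set h | basic_open h `<=` \bigcup_i f i].
apply/seteqP; split=> P; last by move=> [h hf Ph]; exact: hf.
move=> [i _]; have [E fE] := fop i; rewrite fE => -[h Eh Ph].
by exists h => // Q Qh; exists i => //; rewrite fE; exists h.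
Qed.

HB.instance Definition _ (A : comPzRingType) :=
  isOpenTopological.Build (spec A) (@zariski_openT A) (@zariski_openI A)
    (@zariski_open_bigcup A).

(* [g] exhibits [B] as the localization of [A] at the powers of [f]. *)
Definition is_localization (A B : comPzRingType) (f : A) (g : A -> B) : Prop :=
  [/\ exists b, g f * b = 1,
      forall b, exists a n, b * g f ^+ n = g a
    & forall a, g a = 0 -> exists n, f ^+ n * a = 0].

(** * Ringed spaces and schemes *)

Record opens (X : topologicalType) :=
  Opens { opens_set :> set X; opens_open : open opens_set }.

Definition opensT (X : topologicalType) : opens X := Opens (@openT X).

Definition opreim (X Y : topologicalType) (f : X -> Y) (cf : continuous f)
    (V : opens Y) : opens X :=
  Opens (proj1 (continuousP f) cf V (opens_open V)).

Record ringedSpace := RingedSpace {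
  carrier :> topologicalType;
  sec : opens carrier -> comPzRingType;
  res : forall U V : opens carrier, V `<=` U -> {rmorphism sec U -> sec V};
  res_id : forall (U : opens carrier) (h : U `<=` U) (s : sec U), res h s = s;
  res_comp : forall (U V W : opens carrier) (h1 : V `<=` U) (h2 : W `<=` V)
    (h : W `<=` U) (s : sec U), res h2 (res h1 s) = res h s;
  sheaf_sep : forall (I : Type) (V : I -> opens carrier) (U : opens carrier)
    (VU : forall i, V i `<=` U), U `<=` \bigcup_i V i ->
    forall s t : sec U, (forall i, res (VU i) s = res (VU i) t) -> s = t;
  sheaf_glue : forall (I : Type) (V : I -> opens carrier) (U : opens carrier)
    (VU : forall i, V i `<=` U), U `<=` \bigcup_i V i ->
    forall s : forall i, sec (V i),
    (forall i j (W : opens carrier) (Wi : W `<=` V i) (Wj : W `<=` V j),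
      res Wi (s i) = res Wj (s j)) ->
    exists t : sec U, forall i, res (VU i) t = s i }.

(* An isomorphism from (Spec A, O_{Spec A}) onto (U, O_X|U).  The structure
   sheaf of Spec A is the sheaf determined by the localizations A_f on the
   basis of the D(f); so the sheaf part of the isomorphism amounts to
   [theta : A -> O_X(U)] such that every composite A -> O_X(U) -> O_X(phi D(f))
   is the localization of A at f. *)
Definition affine_chart (X : ringedSpace) (U : opens X) (A : comPzRingType)
    (phi : spec A -> X) (theta : {rmorphism A -> sec U}) : Prop :=
  [/\ injective phi, continuous phi,
      forall W : set (spec A), open W -> open (phi @` W),
      range phi = U
    & forall (f : A) (V : opens X) (VU : V `<=` U),
        V = phi @` basic_open f :> set X ->
        is_localization f (fun a => res VU (theta a))].

Definition affine_open (X : ringedSpace) (U : opens X) : Prop :=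
  exists (A : comPzRingType) (phi : spec A -> X)
    (theta : {rmorphism A -> sec U}), affine_chart phi theta.

Record scheme := Scheme {
  ringed_space :> ringedSpace;
  schemeP : forall x : ringed_space,
    exists2 U : opens ringed_space, opens_set U x & affine_open U }.

(** * Morphisms *)

(* The germ of [s] at [x] is a unit of the stalk at [x]. *)
Definition unit_at (X : ringedSpace) (U : opens X) (s : sec U) (x : X) : Prop :=
  exists (W : opens X) (WU : W `<=` U),
    opens_set W x /\ exists t : sec W, res WU s * t = 1.

Record morphism (X Y : scheme) := Morphism {
  mor_fun :> X -> Y;
  mor_cont : continuous mor_fun;
  mor_sharp : forall V : opens Y, {rmorphism sec V -> sec (opreim mor_cont V)};
  mor_res : forall (V W : opens Y) (h : W `<=` V)
    (h' : opreim mor_cont W `<=` opreim mor_cont V) (s : sec V),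
    res h' (mor_sharp V s) = mor_sharp W (res h s);
  (* the homomorphisms induced on stalks are local *)
  mor_local : forall (V : opens Y) (s : sec V) (x : X),
    opens_set V (mor_fun x) ->
    unit_at (mor_sharp V s) x -> unit_at s (mor_fun x) }.

Arguments mor_cont {X Y} m.

Definition mor_eq (X Y : scheme) (f g : morphism X Y) : Prop :=
  f =1 g /\
  forall (V : opens Y) (U : opens X) (Uf : U `<=` opreim (mor_cont f) V)
    (Ug : U `<=` opreim (mor_cont g) V) (s : sec V),
    res Uf (mor_sharp f V s) = res Ug (mor_sharp g V s).

Section IdComp.
Variables X Y Z : scheme.

Lemma id_cont : continuous (@id X).
Proof. by move=> x; exact: cvg_id. Qed.

Lemma id_sub (V : opens X) : opreim id_cont V `<=` V. Proof. by []. Qed.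

Definition id_sharp (V : opens X) :
    {rmorphism sec V -> sec (opreim id_cont V)} :=
  res (@id_sub V).

Lemma id_res (V W : opens X) (h : W `<=` V)
    (h' : opreim id_cont W `<=` opreim id_cont V) (s : sec V) :
  res h' (id_sharp V s) = id_sharp W (res h s).
Proof.
have h1 : opreim id_cont W `<=` V by move=> x /h.
by rewrite /id_sharp !(res_comp _ _ h1).
Qed.

Lemma id_local (V : opens X) (s : sec V) (x : X) :
  opens_set V x -> unit_at (id_sharp V s) x -> unit_at s x.
Proof.
move=> Vx [W [WV [Wx [t st]]]]; exists W, WV; split=> //.
by exists t; rewrite -st /id_sharp res_comp.
Qed.

Definition id_mor : morphism X X := Morphism id_res id_local.

Variables (g : morphism Y Z) (f : morphism X Y).

Lemma comp_cont : continuous (g \o f).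
Proof. by move=> x; apply: continuous_comp; exact: mor_cont. Qed.

Lemma comp_sub (V : opens Z) :
  opreim comp_cont V `<=` opreim (mor_cont f) (opreim (mor_cont g) V).
Proof. by []. Qed.

(* The restriction is along an equality of open sets. *)
Definition comp_sharp (V : opens Z) :
    {rmorphism sec V -> sec (opreim comp_cont V)} :=
  res (@comp_sub V) \o (mor_sharp f (opreim (mor_cont g) V) \o mor_sharp g V).

Lemma comp_res (V W : opens Z) (h : W `<=` V)
    (h' : opreim comp_cont W `<=` opreim comp_cont V) (s : sec V) :
  res h' (comp_sharp V s) = comp_sharp W (res h s).
Proof.
have h1 : opreim (mor_cont g) W `<=` opreim (mor_cont g) V by move=> y /h.
have h2 : opreim (mor_cont f) (opreim (mor_cont g) W) `<=`
    opreim (mor_cont f) (opreim (mor_cont g) V) by move=> x /h.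
rewrite /comp_sharp /= -(mor_res h h1) -(mor_res h1 h2).
have h3 : opreim comp_cont W `<=` opreim (mor_cont f) (opreim (mor_cont g) V).
  by move=> x /h.
by rewrite !(res_comp _ _ h3).
Qed.

Lemma comp_local (V : opens Z) (s : sec V) (x : X) :
  opens_set V (g (f x)) -> unit_at (comp_sharp V s) x -> unit_at s (g (f x)).
Proof.
move=> Vx [W [WV [Wx [t st]]]]; apply: mor_local => //; apply: mor_local => //.
by exists W, WV; split=> //; exists t; rewrite -st /comp_sharp /= res_comp.
Qed.

Definition comp_mor : morphism X Z := Morphism comp_res comp_local.

End IdComp.

Definition closed_immersion (X Y : scheme) (f : morphism X Y) : Prop :=
  [/\ injective f,
      closed (range f),
      forall U : opens X, exists V : opens Y, U = opreim (mor_cont f) V :> set X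
    & (* O_Y -> f_* O_X is surjective *)
      forall (V : opens Y) (s : sec (opreim (mor_cont f) V)) (y : Y),
        opens_set V y ->
        exists (W : opens Y) (WV : W `<=` V)
          (h : opreim (mor_cont f) W `<=` opreim (mor_cont f) V) (t : sec W),
          opens_set W y /\ res h s = mor_sharp f W t].

(** * Schemes over a field *)

Section OverField.
Variable k : fieldType.

(* Spec k is a single point, so a morphism X -> Spec k is a ring homomorphism
   k -> O_X(X). *)
Record schemeOver := SchemeOver {
  over_scheme :> scheme;
  over_str : {rmorphism k -> sec (opensT over_scheme)} }.

Definition mor_over (X Y : schemeOver) (f : morphism X Y) : Prop :=
  forall (h : opensT X `<=` opreim (mor_cont f) (opensT Y)) (c : k),
    res h (mor_sharp f (opensT Y) (over_str Y c)) = over_str X c.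

(* [P] with the projections [p], [q] is the fibre product of X and Y over k. *)
Definition is_product (X Y P : schemeOver) (p : morphism P X)
    (q : morphism P Y) : Prop :=
  [/\ mor_over p, mor_over q
    & forall (T : schemeOver) (a : morphism T X) (b : morphism T Y),
        mor_over a -> mor_over b ->
        exists h : morphism T P,
          [/\ mor_over h, mor_eq (comp_mor p h) a, mor_eq (comp_mor q h) b
            & forall h' : morphism T P, mor_over h' ->
                mor_eq (comp_mor p h') a -> mor_eq (comp_mor q h') b ->
                mor_eq h' h]].

(* The diagonal X -> X x_k X is a closed immersion. *)
Definition is_separated (X : schemeOver) : Prop :=
  exists (P : schemeOver) (p q : morphism P X) (d : morphism X P),
    [/\ is_product p q, mor_over d, mor_eq (comp_mor p d) (id_mor X),
        mor_eq (comp_mor q d) (id_mor X) & closed_immersion d].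

(* The ring [B] is generated, as an algebra over k via [c], by finitely many
   elements. *)
Definition fg_algebra (B : comPzRingType) (c : k -> B) : Prop :=
  exists gens : seq B, forall S : {pred B}, subring_closed S ->
    (forall x, c x \in S) -> {subset gens <= S} -> forall b, b \in S.

Definition of_finite_type (X : schemeOver) : Prop :=
  exists (n : nat) (U : 'I_n -> opens X),
    (forall x : X, exists i, opens_set (U i) x) /\
    forall i, affine_open (U i) /\
      forall h : U i `<=` opensT X,
        fg_algebra (fun c : k => res h (over_str X c)).

End OverField.

(** * Frobenius splittings and closed subschemes *)

(* Elements of Hom_{O_X}(F_* O_X, O_X): since F is the identity on points,
   (F_* O_X)(U) is the additive group O_X(U), on which f in O_X(U) acts as
   multiplication by F^#(f) = f ^+ p. *)
Record frobenius_hom (p : nat) (X : scheme) := FrobeniusHom {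
  frob_fun :> forall U : opens X, {additive sec U -> sec U};
  frob_res : forall (U V : opens X) (h : V `<=` U) (s : sec U),
    res h (frob_fun U s) = frob_fun V (res h s);
  frob_lin : forall (U : opens X) (f g : sec U),
    frob_fun U (f ^+ p * g) = f * frob_fun U g }.

(* The composite of [sigma] with F^# is the identity. *)
Definition is_splitting (p : nat) (X : scheme) (sigma : frobenius_hom p X) :
    Prop :=
  forall (U : opens X) (f : sec U), sigma U (f ^+ p) = f.

(* A closed subscheme is a closed immersion into [X], two of them being
   identified ([same_subscheme]) when they are isomorphic over [X]. *)
Record closed_subscheme (X : scheme) := ClosedSubscheme {
  sub_scheme : scheme;
  sub_mor : morphism sub_scheme X;
  sub_closed : closed_immersion sub_mor }.

Definition same_subscheme (X : scheme) (Y Z : closed_subscheme X) : Prop :=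
  exists (h : morphism (sub_scheme Y) (sub_scheme Z))
    (g : morphism (sub_scheme Z) (sub_scheme Y)),
    [/\ mor_eq (comp_mor g h) (id_mor (sub_scheme Y)),
        mor_eq (comp_mor h g) (id_mor (sub_scheme Z))
      & mor_eq (comp_mor (sub_mor Z) h) (sub_mor Y)].

(* The kernel of O_X -> i_* O_Y, where i : Y -> X is the inclusion. *)
Definition ideal_sheaf (X : scheme) (Y : closed_subscheme X) (U : opens X) :
    set (sec U) :=
  [set s | mor_sharp (sub_mor Y) U s = 0].

Definition compatibly_split (p : nat) (X : scheme) (sigma : frobenius_hom p X)
    (Y : closed_subscheme X) : Prop :=
  forall (U : opens X) (s : sec U),
    ideal_sheaf Y s -> ideal_sheaf Y (sigma U s).

(* Main.v *)
Require Import Defs.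
From HB Require Import structures.
From mathcomp Require Import all_boot all_order all_algebra.
From mathcomp Require Import all_classical.
From mathcomp Require Import topology.
From mathcomp Require Import zify ring.

Set Implicit Arguments.
Unset Strict Implicit.
Unset Printing Implicit Defensive.

Import GRing.Theory.
Local Open Scope classical_set_scope.
Local Open Scope ring_scope.

(** The theorem is first reduced to commutative algebra.  Cover X by finitely
many affine opens U_1, ..., U_n.  A closed subscheme is determined, up to
isomorphism over X, by the kernel of O_X -> i_* O_Y ([ideal_sheaf_inj]), and
that kernel is determined by its sections over the U_i
([sharp_ker_affine_cover]).  If Y is compatibly split, these sections form an
ideal of B = O_X(U_i) stable under sigma, so it is enough that the finitely
generated k-algebra B has finitely many sigma-stable ideals
([finite_stable_ideals_fg]).

That finiteness rests on two properties of the lattice of sigma-stable ideals,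
which is closed under sums and intersections.

It has finite length.  Let x_1, ..., x_n generate B and filter B by the degree
of polynomial expressions in the x_i.  As k is perfect, every term c x^b is of
the form h^p x^a with all a_i < p; hence sigma divides degrees by p, up to an
additive constant.  If f lies in a stable ideal I, write f^(p-1) as a sum of
terms h^p x^a; then f = sigma(f^(p-1) f) is the sum of the h sigma(x^a f), and
the elements sigma(x^a f) of I have smaller degree than f as soon as the degree
of f exceeds a constant D.  So I is generated by its elements of degree at most
D ([stable_ideal_bounded_degree]), and I is determined by its trace on a fixed
finite-dimensional space; the dimension of the trace is a strictly increasing
rank on stable ideals.

It is distributive.  Since sigma(f^p) = f, stable ideals are radical, and
radical ideals satisfy the cancellation law: I and J are equal once I `&` C =
J `&` C and I + C = J + C ([stable_ideal_cancel]).

A distributive lattice of finite length is finite: if C lies strictly between L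
and M, an element I of the interval [L, M] is determined by I `&` C in [L, C] and I + C
in [C, M], and induction on the length applies ([finite_interval]). *)

(** * Ideals of a commutative ring *)

Record is_ideal (B : comPzRingType) (I : set B) : Prop := IsIdeal {
  ideal0 : I 0;
  idealD : forall f g, I f -> I g -> I (f + g);
  idealMl : forall f g, I g -> I (f * g) }.

Lemma ideal_mulr (B : comPzRingType) (I : set B) (f g : B) :
  is_ideal I -> I f -> I (f * g).
Proof. by move=> idI If; rewrite mulrC; exact: idealMl. Qed.

(** * The degree filtration of a finitely generated algebra *)

Section Filtration.
Variables (k : fieldType) (B : comPzRingType) (c : {rmorphism k -> B}).
Variables (n : nat) (x : 'I_n -> B).

Definition monomial (a : 'I_n -> nat) : B := \prod_i x i ^+ a i.

Definition degree (a : 'I_n -> nat) : nat := \sum_i a i.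

(** The elements of degree at most d, as sums of terms: an inductive predicate,
because the arguments below go term by term. *)
Inductive deg_le (d : nat) : set B :=
| deg_le0 : deg_le d 0
| deg_leD t a b : (degree a <= d)%N -> deg_le d b ->
    deg_le d (c t * monomial a + b).

Lemma monomialM a b :
  monomial a * monomial b = monomial (fun i => a i + b i)%N.
Proof. by rewrite -big_split; apply: eq_bigr => i _; rewrite exprD. Qed.

Lemma monomialX a m : monomial a ^+ m = monomial (fun i => a i * m)%N.
Proof. by rewrite -prodrXl; apply: eq_bigr => i _; rewrite exprM. Qed.

Lemma degreeD a b : degree (fun i => a i + b i)%N = (degree a + degree b)%N.
Proof. by rewrite /degree big_split. Qed.

Lemma deg_le_monomial t a d : (degree a <= d)%N -> deg_le d (c t * monomial a).
Proof.
by move=> ad; rewrite -[_ * _]addr0; apply: deg_leD => //; exact: deg_le0.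
Qed.

Lemma deg_le_add d f g : deg_le d f -> deg_le d g -> deg_le d (f + g).
Proof.
move=> df dg; elim: df => [|t a b ad _ IH]; first by rewrite add0r.
by rewrite -addrA; apply: deg_leD.
Qed.

Lemma deg_leW d e f : (d <= e)%N -> deg_le d f -> deg_le e f.
Proof.
move=> de; elim=> [|t a b ad _ IH]; first exact: deg_le0.
by apply: deg_leD => //; exact: leq_trans de.
Qed.

Lemma deg_le_mul d e f g : deg_le d f -> deg_le e g -> deg_le (d + e) (f * g).
Proof.
move=> df dg; elim: df => [|t a b ad _ IH]; first by rewrite mul0r; exact: deg_le0.
rewrite mulrDl; apply: deg_le_add => {IH} //.
elim: dg => [|u a' b' ad' _ IH]; first by rewrite mulr0; exact: deg_le0.
rewrite mulrDr mulrACA -rmorphM monomialM; apply: deg_leD => //.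
by rewrite degreeD leq_add.
Qed.

Lemma deg_leC t : deg_le 0 (c t).
Proof.
have -> : c t = c t * monomial (fun=> 0%N).
  by rewrite /monomial big1 ?mulr1 // => i _; rewrite expr0.
by apply: deg_le_monomial; rewrite /degree big1.
Qed.

Lemma deg_le_gen i : deg_le 1 (x i).
Proof.
have -> : x i = c 1 * monomial (fun j => j == i).
  rewrite rmorph1 mul1r /monomial (bigD1 i) //= eqxx expr1 big1 ?mulr1 // => j.
  by move=> /negPf->; rewrite expr0.
apply: deg_le_monomial; rewrite /degree (bigD1 i) //= eqxx big1 // => j.
by move=> /negPf->.
Qed.


(** The exponents at most d in each variable: a finite type containing the
exponents of total degree at most d, so that [box_comb d] maps a
finite-dimensional space onto a space containing [deg_le c x d]. *)
Definition box (d : nat) := {ffun 'I_n -> 'I_d.+1}.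

Definition box_comb (d : nat) (v : 'rV[k]_#|{: box d}|) : B :=
  \sum_(a : box d) c (v 0 (enum_rank a)) * monomial (fun i => a i).

Lemma box_comb0 d : box_comb (0 : 'rV_#|{: box d}|) = 0.
Proof. by rewrite /box_comb big1 // => a _; rewrite mxE rmorph0 mul0r. Qed.

Lemma box_combD d (u v : 'rV_#|{: box d}|) :
  box_comb (u + v) = box_comb u + box_comb v.
Proof.
rewrite /box_comb -big_split; apply: eq_bigr => a _ /=.
by rewrite mxE rmorphD mulrDl.
Qed.

Lemma box_combZ d t (v : 'rV_#|{: box d}|) : box_comb (t *: v) = c t * box_comb v.
Proof.
rewrite /box_comb mulr_sumr; apply: eq_bigr => a _.
by rewrite mxE rmorphM mulrA.
Qed.

Lemma deg_le_box_comb d f : deg_le d f -> exists v, f = box_comb (v : 'rV_#|{: box d}|).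
Proof.
elim=> [|t a b ad _ [v ->]]; first by exists 0; rewrite box_comb0.
pose a' : box d := [ffun i => inord (a i)].
exists (t *: delta_mx 0 (enum_rank a') + v); rewrite box_combD box_combZ.
congr (c t * _ + _); rewrite /box_comb (bigD1 a') //= big1 => [|b' b'a].
  rewrite mxE !eqxx rmorph1 mul1r addr0; apply: eq_bigr => i _.
  rewrite ffunE inordK // ltnS; apply: leq_trans ad.
  by rewrite /degree (bigD1 i) //= leq_addr.
rewrite mxE (inj_eq enum_rank_inj) (negPf b'a) andbF rmorph0.
by rewrite mul0r.
Qed.

End Filtration.

Lemma fg_algebra_deg_le (k : fieldType) (B : comPzRingType)
    (c : {rmorphism k -> B}) :
  fg_algebra c ->
  exists (n : nat) (x : 'I_n -> B), forall f, exists d, deg_le c x d f.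
Proof.
move=> [gens gensP]; exists (size gens), (fun i => tnth (in_tuple gens) i).
set x := (fun i => _).
suff H f : f \in [pred f | `[< exists d, deg_le c x d f >]].
  by move=> f; have /asboolP := H f.
apply: gensP; first split.
- by apply/asboolP; exists 0%N; rewrite -(rmorph1 c); exact: deg_leC.
- move=> g h /asboolP[d dg] /asboolP[e eh]; apply/asboolP; exists (maxn d e).
  apply: deg_le_add; first by apply: deg_leW dg; rewrite leq_maxl.
  rewrite -mulN1r -(rmorphN1 c) -[maxn d e]add0n; apply: deg_le_mul (deg_leC _ _ _) _.
  by apply: deg_leW eh; rewrite leq_maxr.
- move=> g h /asboolP[d dg] /asboolP[e eh]; apply/asboolP; exists (d + e)%N.
  exact: deg_le_mul.
- by move=> t; apply/asboolP; exists 0%N; exact: deg_leC.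
- move=> g /(tnthP (in_tuple gens))[i ->]; apply/asboolP; exists 1%N.
  exact: deg_le_gen.
Qed.

(** * The lattice of ideals stable under a Frobenius splitting *)

Section FrobIdeals.
Variables (B : comPzRingType) (p : nat) (sigma : {additive B -> B}).

Definition stable_ideal (I : set B) : Prop :=
  is_ideal I /\ forall f, I f -> I (sigma f).

Lemma stable_idealI I J :
  stable_ideal I -> stable_ideal J -> stable_ideal (I `&` J).
Proof.
move=> [idI sI] [idJ sJ]; split; last by move=> f [If Jf]; split; [exact: sI|exact: sJ].
split; first by split; exact: ideal0.
  by move=> f g [If Jf] [Ig Jg]; split; exact: idealD.
by move=> f g [Ig Jg]; split; exact: idealMl.
Qed.

Definition ideal_sum (I J : set B) : set B :=
  [set h | exists f g, [/\ I f, J g & h = f + g]].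

Lemma stable_ideal_sum I J :
  stable_ideal I -> stable_ideal J -> stable_ideal (ideal_sum I J).
Proof.
move=> [idI sI] [idJ sJ]; split; last first.
  move=> _ [f [g [If Jg ->]]]; exists (sigma f), (sigma g).
  by split; [exact: sI|exact: sJ|rewrite raddfD].
split; first by exists 0, 0; rewrite addr0; split=> //; exact: ideal0.
  move=> _ _ [f [g [If Jg ->]]] [f' [g' [If' Jg' ->]]].
  by exists (f + f'), (g + g'); rewrite addrACA; split=> //; exact: idealD.
move=> h _ [f [g [If Jg ->]]].
by exists (h * f), (h * g); rewrite mulrDr; split=> //; exact: idealMl.
Qed.

Lemma ideal_suml I J : is_ideal J -> I `<=` ideal_sum I J.
Proof. by move=> idJ f If; exists f, 0; rewrite addr0; split=> //; exact: ideal0. Qed.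

Lemma ideal_sumr I J : is_ideal I -> J `<=` ideal_sum I J.
Proof. by move=> idI f Jf; exists 0, f; rewrite add0r; split=> //; exact: ideal0. Qed.

Hypothesis p_gt1 : (1 < p)%N.
Hypothesis sigma_split : forall f, sigma (f ^+ p) = f.

(** f = sigma (f ^+ p), and f ^+ p is a multiple of f * f as p >= 2. *)
Lemma stable_ideal_radical I f : stable_ideal I -> I (f * f) -> I f.
Proof.
move=> [idI sI] Iff; rewrite -[f]sigma_split; apply: sI.
have -> : p = (2 + (p - 2))%N by lia.
by rewrite exprD expr2; exact: ideal_mulr.
Qed.

(** For f in I, write f = g + h with g in J and h in C: then f * f = f * g +
f * h, where f * h lies in I `&` C, so f * f is in J, and J is radical. *)
Lemma stable_ideal_cancel_sub I J C :
  stable_ideal I -> stable_ideal J -> stable_ideal C ->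
  I `&` C `<=` J `&` C -> ideal_sum I C `<=` ideal_sum J C -> I `<=` J.
Proof.
move=> sI sJ sC IJcap IJsum f If.
have /IJsum[g [h [Jg Ch fE]]] : ideal_sum I C f by apply: ideal_suml If; exact: sC.1.
apply: (stable_ideal_radical sJ); rewrite {2}fE mulrDr.
apply: (idealD sJ.1); first exact: (idealMl sJ.1).
suff [] : (J `&` C) (f * h) by [].
apply: IJcap; split; first exact: (ideal_mulr _ sI.1).
exact: (idealMl sC.1).
Qed.

Lemma stable_ideal_cancel I J C :
  stable_ideal I -> stable_ideal J -> stable_ideal C ->
  I `&` C = J `&` C -> ideal_sum I C = ideal_sum J C -> I = J.
Proof.
move=> sI sJ sC IJcap IJsum; apply/seteqP; split.
  by apply: (stable_ideal_cancel_sub sI sJ sC); rewrite ?IJcap ?IJsum.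
by apply: (stable_ideal_cancel_sub sJ sI sC); rewrite ?IJcap ?IJsum.
Qed.

(** A rank on the lattice of stable ideals bounds the lengths of its chains. *)
Definition strict_rank (rk : set B -> nat) : Prop :=
  forall I J, stable_ideal I -> stable_ideal J -> I `<=` J -> ~ J `<=` I ->
    (rk I < rk J)%N.

(** By cancellation, I |-> (I `&` C, I + C) is injective on the interval [L, M];
for C strictly between L and M it takes values in two intervals of smaller
length. *)
Lemma finite_interval (rk : set B -> nat) (L M : set B) :
  strict_rank rk -> stable_ideal L -> stable_ideal M ->
  finite_set [set I | [/\ stable_ideal I, L `<=` I & I `<=` M]].
Proof.
move=> rkP sL sM; have [m] := ubnP (rk M - rk L)%N.
elim: m => // m IH in L M sL sM *; rewrite ltnS => rkm.
have [[C [sC LC CM nCL nMC]]|noC] := pselect (exists C, [/\ stable_ideal C,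
    L `<=` C, C `<=` M, ~ C `<=` L & ~ M `<=` C]); last first.
  apply: (@sub_finite_set _ _ ([set L] `|` [set M])).
      move=> I [sI LI IM].
    have [IL|nIL] := pselect (I `<=` L); first by left; exact/seteqP.
    have [MI|nMI] := pselect (M `<=` I); first by right; exact/seteqP.
    by case: noC; exists I.
  by rewrite finite_setU; split; exact: finite_set1.
have rkLC := rkP _ _ sL sC LC nCL; have rkCM := rkP _ _ sC sM CM nMC.
have finLC : finite_set [set I | [/\ stable_ideal I, L `<=` I & I `<=` C]].
  by apply: IH => //; lia.
have finCM : finite_set [set I | [/\ stable_ideal I, C `<=` I & I `<=` M]].
  by apply: IH => //; lia.
(* The inverse of I |-> (I `&` C, I + C), so that the interval is covered by
   the image of a finite set. *)
pose rebuild (UV : set B * set B) : set B := get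
  [set I | [/\ stable_ideal I, I `&` C = UV.1 & ideal_sum I C = UV.2]].
apply: sub_finite_set (finite_image rebuild (finite_setX finLC finCM)).
move=> I [sI LI IM]; exists (I `&` C, ideal_sum I C).
  split; split.
  - exact: stable_idealI.
  - by move=> f Lf; split; [exact: LI|exact: LC].
  - by move=> f [].
  - exact: stable_ideal_sum.
  - by apply: ideal_sumr; exact: sI.1.
  - by move=> _ [f [g [/IM Mf /CM Mg ->]]]; exact: (idealD sM.1).
rewrite /rebuild; case: xgetP => [J _ [sJ JC JS]|/(_ I)].
  exact: (stable_ideal_cancel sJ sI sC).
by case.
Qed.

Lemma finite_stable_ideals (rk : set B -> nat) :
  strict_rank rk -> finite_set stable_ideal.
Proof.
move=> rkP.
have s0 : stable_ideal [set 0].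
  split; last by move=> f ->; rewrite raddf0.
  by split=> [//|f g -> ->|f g ->]; rewrite ?addr0 ?mulr0.
have sT : stable_ideal [set: B] by [].
apply: sub_finite_set (finite_interval rkP s0 sT) => I sI; split=> //.
by move=> f ->; exact: (ideal0 sI.1).
Qed.

End FrobIdeals.

(** * Stable ideals of a finitely generated algebra *)

(** A stable ideal is generated by its elements of degree at most D, in the form
that is used: an ideal J containing these contains I.  In degree d > D, f is a
combination of elements sigma (x^a * f) with a_i < p, which have degree at most
(n (p - 1) + d) / p + C; this is smaller than d because D = 2 C + n. *)
Lemma stable_ideal_bounded_degree (k : fieldType) (B : comPzRingType)
  (c : {rmorphism k -> B}) (p : nat) (sigma : {additive B -> B})
  (p_gt1 : (1 < p)%N) (k_perfect : forall t : k, exists s, s ^+ p = t) 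
  (sigma_lin : forall f g, sigma (f ^+ p * g) = f * sigma g)
  (sigma_split : forall f, sigma (f ^+ p) = f)
  (n : nat) (x : 'I_n -> B) (xgen : forall f, exists d, deg_le c x d f) :
  exists D, forall I J, stable_ideal sigma I -> is_ideal J ->
    I `&` deg_le c x D `<=` J -> I `<=` J.
Proof.
have p_gt0 : (0 < p)%N by lia.
(* With s ^+ p = t, the term t x^a equals (s x^(a / p)) ^+ p * x^(a mod p). *)
have frob_div t a : exists s, forall g, sigma (c t * monomial x a * g) =
    c s * monomial x (fun i => a i %/ p)%N *
    sigma (monomial x (fun i => a i %% p)%N * g).
  have [s <-] := k_perfect t; exists s => g; rewrite -sigma_lin.
  rewrite exprMn -rmorphXn monomialX !mulrA -[in RHS](mulrA (c _)) monomialM.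
  congr (sigma (_ * _ * _)); apply: eq_bigr => i _; congr (_ ^+ _).
  exact: divn_eq.
(* C bounds the degrees of the finitely many sigma (x^a) with all a_i < p. *)
have [C CP] : exists C, forall a, (forall i, a i < p)%N ->
    deg_le c x C (sigma (monomial x a)).
  have /choice[C_ C_P] : forall a : {ffun 'I_n -> 'I_p}, exists C,
      deg_le c x C (sigma (monomial x (fun i => a i))) by move=> a; exact: xgen.
  exists (\max_a C_ a) => a ap.
  have := C_P [ffun i => Ordinal (ap i)].
  have -> : monomial x (fun i => [ffun i => Ordinal (ap i)] i) = monomial x a.
    by apply: eq_bigr => i _; rewrite ffunE.
  by apply: deg_leW; exact: leq_bigmax.
have degree_div a : (degree (fun i => a i %/ p)%N * p <= degree (a : 'I_n -> nat))%N.
  rewrite /degree big_distrl /=; apply: leq_sum => i _; exact: leq_trunc_div.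
have degree_mod a : (degree (fun i : 'I_n => a i %% p)%N <= n * p.-1)%N.
  rewrite /degree -[X in (X * _)%N](card_ord n) -sum_nat_const.
  by apply: leq_sum => i _; rewrite -ltnS prednK // ltn_mod.
have sigma_deg d f : deg_le c x d f -> deg_le c x (d %/ p + C) (sigma f).
  elim=> [|t a b ad _ IH]; first by rewrite raddf0; exact: deg_le0.
  rewrite raddfD; apply: deg_le_add => //.
  have [s] := frob_div t a; move/(_ 1); rewrite !mulr1 => ->.
  apply: deg_le_mul; last by apply: CP => i; rewrite ltn_mod.
  by apply: deg_le_monomial; rewrite leq_divRL //; exact: leq_trans ad.
exists (2 * C + n)%N => I J [idI sI] idJ IJ f If.
have [d df] := xgen f.
elim/ltn_ind: d f If df => d IH f If df.
have [dle|dgt] := leqP d (2 * C + n)%N; first by apply: IJ; split=> //; exact: deg_leW df.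
(* Applied to g = f ^+ p.-1. *)
suff H e g : deg_le c x e g -> J (sigma (g * f)).
  rewrite -[f]sigma_split -(prednK p_gt0) exprSr.
  by have [e] := xgen (f ^+ p.-1); exact: H.
elim=> [|t a b _ _ IHb]; first by rewrite mul0r raddf0; exact: ideal0.
rewrite mulrDl raddfD; apply: idealD => //.
have [s ->] := frob_div t a; apply: idealMl => //.
have xf_deg : deg_le c x (n * p.-1 + d) (monomial x (fun i => a i %% p)%N * f).
  apply: deg_le_mul df; rewrite -[monomial _ _]mul1r -(rmorph1 c).
  exact: deg_le_monomial.
apply: IH (sI _ (idealMl idI _ If)) (sigma_deg _ _ xf_deg).
have := leq_trunc_div (n * p.-1 + d) p; set q := (_ %/ _)%N => qle.
rewrite ltnNge; apply/negP => dq.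
have : ((d - C) * p <= n * p.-1 + d)%N by apply: leq_trans qle; rewrite leq_mul2r; lia.
nia.
Qed.

(** A matrix of maximal rank among those whose rows lie in W spans W. *)
Lemma row_subspace_mx (k : fieldType) (m : nat) (W : set 'rV[k]_m) :
  W 0 -> (forall u v, W u -> W v -> W (u + v)) ->
  (forall t v, W v -> W (t *: v)) ->
  exists M : 'M[k]_m, forall v, W v <-> (v <= M)%MS.
Proof.
move=> W0 WD WZ.
pose P r := `[< exists M : 'M[k]_m, (forall v, (v <= M)%MS -> W v) /\ \rank M = r >].
have P0 : exists r, P r.
  exists 0%N; apply/asboolP; exists 0; split; last exact: mxrank0.
  by move=> v; rewrite submx0 => /eqP->.
have Pm r : P r -> (r <= m)%N by move/asboolP => [M [_ <-]]; exact: rank_leq_row.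
have [r /asboolP[M [MW rM]] maxr] := ex_maxnP P0 Pm.
exists M => v; split=> [Wv|]; last exact: MW.
have Wadd w : (w <= M + v)%MS -> W w.
  move/sub_addsmxP => [[u1 u2] ->] /=; apply: WD; first by apply: MW; exact: submxMl.
  by rewrite [u2]mx11_scalar mul_scalar_mx; exact: WZ.
have : (\rank (M + v)%MS <= r)%N.
  apply: maxr; apply/asboolP; exists (M + v)%MS; split=> //.
rewrite -rM => rkle; apply: contraT => nvM.
suff : (M < M + v)%MS by move/rank_ltmx; rewrite ltnNge rkle.
rewrite ltmxE addsmxSl /=; apply: contra nvM; exact: submx_trans (addsmxSr _ _).
Qed.

(** The rank of a stable ideal is the dimension of its trace on the span of the
monomials with exponents at most D. *)
Theorem finite_stable_ideals_fg (k : fieldType) (B : comPzRingType)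
  (c : {rmorphism k -> B}) (p : nat) (sigma : {additive B -> B})
  (p_gt1 : (1 < p)%N) (k_perfect : forall t : k, exists s, s ^+ p = t) 
  (sigma_lin : forall f g, sigma (f ^+ p * g) = f * sigma g)
  (sigma_split : forall f, sigma (f ^+ p) = f) :
  fg_algebra c -> finite_set (stable_ideal sigma).
Proof.
move=> /fg_algebra_deg_le[n [x xgen]].
have [D DP] := stable_ideal_bounded_degree p_gt1 k_perfect sigma_lin sigma_split xgen.
have trace I : exists M : 'M[k]_#|{: box n D}|, is_ideal I ->
    forall v, I (box_comb c x v) <-> (v <= M)%MS.
  have [idI|nidI] := pselect (is_ideal I); last by exists 0.
  have [||t v Iv|M MP] := @row_subspace_mx k _
      [set v | I (box_comb c x (v : 'rV_#|{: box n D}|))].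
  - by rewrite /= box_comb0; exact: ideal0.
  - by move=> u v /= Iu Iv; rewrite box_combD; exact: idealD.
  - by rewrite /= box_combZ; exact: idealMl.
  - by exists M.
have [M MP] := choice trace.
apply: (finite_stable_ideals p_gt1 sigma_split (rk := fun I => \rank (M I))).
move=> I J sI sJ IJ nJI; apply: rank_ltmx; rewrite ltmxE; apply/andP; split.
  by apply/row_subP => i; apply/(MP J sJ.1); apply: IJ; apply/(MP I sI.1); exact: row_sub.
apply/negP => MJI; apply: nJI; apply: (DP _ _ sJ sI.1) => f [Jf].
move=> /deg_le_box_comb[v fE]; rewrite fE in Jf *.
by apply/(MP I sI.1); apply: submx_trans MJI; apply/(MP J sJ.1).
Qed.

(** * Prime spectra *)

(** A maximal element among the proper ideals containing J is prime. *)
Lemma exists_prime (A : comPzRingType) (J : set A) :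
  is_ideal J -> ~ J 1 -> exists P : spec A, J `<=` spec_ideal P.
Proof.
move=> idJ J1; pose P S := is_ideal (S `|` J) /\ ~ (S `|` J) 1.
(* Zorn's lemma is applied to the sets S such that S `|` J is a proper ideal,
   rather than to the ideals containing J: the empty chain then has an upper
   bound of the same form. *)
have [F FP Ftot|S [[idS S1] Smax]] := @Zorn_bigcup _ P.
  split; last by case=> [[S FS S1]|//]; case: (FP _ FS) => _; apply; left.
  have FJ S f : F S -> (S `|` J) f -> (\bigcup_(X in F) X `|` J) f.
    by move=> FS [Sf|Jf]; [left; exists S|right].
  have get_S f : (\bigcup_(X in F) X `|` J) f ->
      J f \/ exists2 S, F S & S f by case=> [[S FS Sf]|Jf]; [right; exists S|left].
  split; first by right; exact: ideal0.
    move=> f g /get_S[Jf|[S FS Sf]] /get_S[Jg|[T FT Tg]].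
    - by right; exact: idealD.
    - by apply: (FJ T) => //; apply: (idealD (FP _ FT).1); [right|left].
    - by apply: (FJ S) => //; apply: (idealD (FP _ FS).1); [left|right].
    - have [ST|TS] := Ftot _ _ FS FT.
        by apply: (FJ T) => //; apply: (idealD (FP _ FT).1); left => //; exact: ST.
      by apply: (FJ S) => //; apply: (idealD (FP _ FS).1); left => //; exact: TS.
  move=> f g /get_S[Jg|[S FS Sg]]; first by right; exact: idealMl.
  by apply: (FJ S) => //; apply: (idealMl (FP _ FS).1); left.
have primeS : is_prime (S `|` J).
  split=> //; [exact: ideal0|exact: idealD|exact: idealMl|] => a b Sab.
  have [Sa|nSa] := pselect ((S `|` J) a); first by left.
  right; pose I : set A := [set h | exists q r, (S `|` J) q /\ h = q + r * a].
  have SI : S `|` J `<=` I by move=> q Sq; exists q, 0; rewrite mul0r addr0.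
  have idI : is_ideal I.
    split; first exact: SI (ideal0 idS).
      move=> _ _ [q [r [Sq ->]]] [q' [r' [Sq' ->]]]; exists (q + q'), (r + r').
      by rewrite mulrDl addrACA; split=> //; exact: (idealD idS).
    move=> h _ [q [r [Sq ->]]]; exists (h * q), (h * r).
    by rewrite mulrDr mulrA; split=> //; exact: (idealMl idS).
  have IJ : I `|` J = I by apply/setUidPl => q Jq; apply: SI; right.
  have [[q [r [Sq E]]]|nI1] := pselect (I 1).
    rewrite -[b]mul1r E mulrDl; apply: (idealD idS); first exact: ideal_mulr.
    by rewrite -mulrA; exact: (idealMl idS).
  exfalso; apply: (Smax I); last by rewrite /P IJ.
  split=> [q Sq|IS]; first by apply: SI; left.
  by apply: nSa; left; apply: IS; exists 0, 1; rewrite add0r mul1r; split=> //; exact: ideal0.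
by exists (Spec primeS) => q Jq; right.
Qed.

Lemma open_basic_open (A : comPzRingType) (f : A) : open (basic_open f).
Proof. by exists [set f]; rewrite bigcup_set1. Qed.

Lemma basic_open_nbhs (A : comPzRingType) (W : set (spec A)) (P : spec A) :
  open W -> W P -> exists f, basic_open f P /\ basic_open f `<=` W.
Proof.
move=> [E ->] [f Ef Pf]; exists f; split=> // Q Qf.
by exists f.
Qed.

Lemma basic_openM (A : comPzRingType) (f g : A) :
  basic_open (f * g) = basic_open f `&` basic_open g.
Proof.
apply/seteqP; split=> P /=; last by move=> [Pf Pg] /(primeM (spec_prime P))[].
move=> Pfg; split=> [Pf|Pg]; apply: Pfg; last exact: primeMl (spec_prime P) _ _ Pg.
by rewrite mulrC; exact: primeMl (spec_prime P) _ _ Pf.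
Qed.

Lemma spec_ideal_exp (A : comPzRingType) (P : spec A) (f : A) n :
  spec_ideal P (f ^+ n) -> spec_ideal P f.
Proof.
elim: n => [/(prime1 (spec_prime P))//|n IH].
by rewrite exprS => /(primeM (spec_prime P))[].
Qed.

(** * Sections of ringed spaces and affine charts *)

Section RingedSpace.
Variable X : ringedSpace.
Implicit Types U V W : opens X.

Definition opensI U V : opens X := Opens (openI (opens_open U) (opens_open V)).

Lemma opensI_subl U V : opensI U V `<=` U. Proof. by move=> x []. Qed.
Lemma opensI_subr U V : opensI U V `<=` V. Proof. by move=> x []. Qed.

Lemma opens_eq U V : U = V :> set X -> U = V.
Proof.
by case: U V => U oU [V oV] /= UV; subst V; rewrite (Prop_irrelevance oU oV).
Qed.

Lemma res_irr U V (h h' : V `<=` U) (s : sec U) : res h s = res h' s.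
Proof. by rewrite (Prop_irrelevance h h'). Qed.

Lemma res_eq_sub U V U' W (hU : W `<=` U) (hV : W `<=` V)
    (h : U' `<=` U) (h' : U' `<=` V) (s : sec U) (t : sec V) :
  W `<=` U' -> res h s = res h' t -> res hU s = res hV t.
Proof. by move=> WU' st; rewrite -(res_comp h WU' hU) st (res_comp h' WU' hV). Qed.

Lemma sec_local_eq U (s t : sec U) :
  (forall x, opens_set U x -> exists W (WU : W `<=` U),
     opens_set W x /\ res WU s = res WU t) -> s = t.
Proof.
move=> loc.
have /choice[F FP] : forall x : {x | opens_set U x}, exists W : {W : opens X | W `<=` U},
    opens_set (sval W) (sval x) /\ res (proj2_sig W) s = res (proj2_sig W) t.
  by move=> [x Ux]; have [W [WU WP]] := loc x Ux; exists (exist _ W WU).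
apply: (sheaf_sep (VU := fun x => proj2_sig (F x))) => [x Ux|x].
  by exists (exist _ x Ux); last exact: (FP (exist _ x Ux)).1.
exact: (FP x).2.
Qed.

Lemma sec_empty U (s t : sec U) : (forall x, ~ opens_set U x) -> s = t.
Proof. by move=> U0; apply: sec_local_eq => x /U0. Qed.

Lemma unit_at_res U V (VU : V `<=` U) (s : sec U) x :
  opens_set V x -> unit_at s x <-> unit_at (res VU s) x.
Proof.
move=> Vx; split=> [] [W [WU [Wx [t st]]]].
  exists (opensI V W), (@opensI_subl V W); split=> //; exists (res (@opensI_subr V W) t).
  have h : opensI V W `<=` U by move=> y [/VU].
  by rewrite (res_comp _ _ h) -(res_comp WU (@opensI_subr V W) h) -rmorphM st rmorph1.
have h : W `<=` U by move=> y /WU/VU.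
by exists W, h; split=> //; exists t; rewrite -st (res_comp _ _ h).
Qed.

End RingedSpace.

Section Chart.
Variables (X : ringedSpace) (U : opens X) (A : comPzRingType).
Variables (phi : spec A -> X) (theta : {rmorphism A -> sec U}).
Hypothesis chart : affine_chart phi theta.

Definition chart_basic (f : A) : opens X :=
  let: And5 _ _ phi_open _ _ := chart in
  Opens (phi_open _ (open_basic_open f)).

Lemma chart_basicE f : chart_basic f = phi @` basic_open f :> set X.
Proof. by rewrite /chart_basic; case: chart. Qed.

Lemma chart_pt x : opens_set U x -> exists P, x = phi P.
Proof. by case: chart => _ _ _ rangeU _; rewrite -rangeU => -[P _ <-]; exists P. Qed.

Lemma chart_basic_sub f : chart_basic f `<=` U.
Proof.
rewrite chart_basicE; case: chart => _ _ _ rangeU _ _ [P _ <-].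
by rewrite -rangeU; exists P.
Qed.

Lemma chart_basicP f P : opens_set (chart_basic f) (phi P) <-> ~ spec_ideal P f.
Proof.
rewrite chart_basicE; case: chart => phi_inj _ _ _ _.
by split=> [[Q Qf /phi_inj <-]//|Pf]; exists P.
Qed.

Lemma chart_loc f :
  is_localization f (fun a => res (@chart_basic_sub f) (theta a)).
Proof. by case: (chart) => _ _ _ _; apply; exact: chart_basicE. Qed.

Lemma chart_basic_nbhs x (V : opens X) : opens_set U x -> opens_set V x ->
  exists f, opens_set (chart_basic f) x /\ chart_basic f `<=` V.
Proof.
move=> /chart_pt[P ->] Vx.
have [|//|f [Pf fV]] := @basic_open_nbhs A (phi @^-1` V) P.
  by case: chart => _ /continuousP phi_cont _ _ _; exact: phi_cont (opens_open V).
exists f; split; first exact/chart_basicP.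
by rewrite chart_basicE => _ [Q /fV ? <-].
Qed.

(** If f * t = 1 near [phi P], then f * a = g ^+ n up to g-torsion for some g
not in P, so f in P would put a power of g in P. *)
Lemma chart_unit f P : unit_at (theta f) (phi P) -> ~ spec_ideal P f.
Proof.
move=> [W [WU [Wx [t ft]]]] Pf.
have [g [gx gW]] := chart_basic_nbhs (WU _ Wx) Wx.
have Pg := (chart_basicP g P).1 gx.
have [_ /(_ (res gW t))[a [n tE]] ker] := chart_loc g.
have [|m] := ker (f * a - g ^+ n).
  rewrite !(rmorphB, rmorphM, rmorphXn) /= -tE.
  rewrite -(res_comp WU gW (@chart_basic_sub g) (theta f)) mulrA -(rmorphM (res gW)) ft rmorph1.
  by rewrite mul1r subrr.
move=> E; apply: Pg; apply: (@spec_ideal_exp _ _ _ (m + n)).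
have -> : g ^+ (m + n) = (g ^+ m * a) * f.
  by apply/eqP; rewrite eq_sym -subr_eq0 exprD -E; apply/eqP; ring.
exact: primeMl (spec_prime P) _ _ Pf.
Qed.

(** Up to powers of g, F and b come from elements f and a of A.  On D(g f) the
section F is invertible, so a vanishes there and is annihilated by a power of
g f; over D(g), where g is invertible, this gives a power of F. *)
Lemma chart_annihilate g (F b : sec (chart_basic g)) :
  (forall (V : opens X) (VW : V `<=` chart_basic g),
     (forall y, opens_set V y -> unit_at F y) -> res VW b = 0) ->
  exists n, F ^+ n * b = 0.
Proof.
move=> Fb; have [[e Ge] surj ker] := chart_loc g.
have [a [m aE]] := surj b; have [f [l fE]] := surj F.
set G := res _ _ in Ge.
have GV : chart_basic (g * f) `<=` chart_basic g.
  rewrite !chart_basicE basic_openM; exact: image_subset.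
have [[u Vu] _ kerV] := chart_loc (g * f).
have resG : res GV G = res (@chart_basic_sub (g * f)) (theta g).
  exact: res_comp.
have resf : res GV (F * G ^+ l) = res (@chart_basic_sub (g * f)) (theta f).
  by rewrite fE; exact: res_comp.
have Vb : res GV b = 0.
  apply: Fb => y Vy; exists (chart_basic (g * f)), GV; split=> //.
  exists (res GV (G ^+ l) * (res GV G * u)).
  by rewrite mulrA -rmorphM resf resG mulrCA mulrA -rmorphM -rmorphM.
have [|N EN] := kerV a.
  by rewrite -(res_comp (@chart_basic_sub g) GV) -aE rmorphM Vb mul0r.
exists N.
have EN' : (G * (F * G ^+ l)) ^+ N * (b * G ^+ m) = 0.
  rewrite fE aE -rmorphM -rmorphM -!rmorphXn -!rmorphM EN.
  by rewrite !rmorph0.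
have -> : F ^+ N * b = (e * e ^+ l) ^+ N * e ^+ m * ((G * (F * G ^+ l)) ^+ N * (b * G ^+ m)).
  have Ge' i : G ^+ i * e ^+ i = 1 by rewrite -exprMn Ge expr1n.
  transitivity (((G * e) * (G ^+ l * e ^+ l)) ^+ N * (G ^+ m * e ^+ m) * (F ^+ N * b)).
    by rewrite !Ge' Ge mul1r expr1n !mul1r.
  by rewrite !exprMn; ring.
by rewrite EN' mulr0.
Qed.

End Chart.

(** Nonempty opens have nonzero rings of sections: if 1 = 0, the germ of 0 at a
point [phi P] of a chart is a unit, against 0 being in P. *)
Lemma sec_neq0 (X : scheme) (U : opens X) x :
  opens_set U x -> (1 : sec U) <> 0.
Proof.
move=> Ux E; have [V Vx [A [phi [theta chart]]]] := schemeP x.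
have [P xE] := chart_pt chart Vx; rewrite xE in Ux Vx.
apply: (@chart_unit _ _ _ _ _ chart 0 P); last exact: prime0 (spec_prime P).
exists (opensI U V), (@opensI_subr _ U V); split=> //; exists 0.
by rewrite mulr0 -(rmorph1 (res (@opensI_subl _ U V))) E rmorph0.
Qed.

(** * The kernel of the comorphism of a closed immersion *)

Section Kernel.
Variables (Y X : scheme) (i : morphism Y X).

Lemma sharp_ker_res (V W : opens X) (h : W `<=` V) (s : sec V) :
  mor_sharp i V s = 0 -> mor_sharp i W (res h s) = 0.
Proof.
move=> s0; have h' : opreim (mor_cont i) W `<=` opreim (mor_cont i) V.
  by move=> y /h.
by rewrite -(mor_res h h') s0 rmorph0.
Qed.

Lemma sharp_ker_local (V : opens X) (s : sec V) :
  (forall y, opens_set V (i y) -> exists (W : opens X) (h : W `<=` V),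
    opens_set W (i y) /\ mor_sharp i W (res h s) = 0) ->
  mor_sharp i V s = 0.
Proof.
move=> loc; apply: sec_local_eq => y /loc[W [h [Wy sW]]].
have h' : opreim (mor_cont i) W `<=` opreim (mor_cont i) V by move=> z /h.
by exists (opreim (mor_cont i) W), h'; split=> //; rewrite (mor_res h) sW rmorph0.
Qed.

Lemma sharp_eq_res (V W : opens X) (s : sec V) (t : sec W) (h : opensI V W `<=` V)
  (h' : opensI V W `<=` W) (T : opens Y) (hT : T `<=` opreim (mor_cont i) V)
   (hT' : T `<=` opreim (mor_cont i) W) :
  mor_sharp i (opensI V W) (res h s) = mor_sharp i (opensI V W) (res h' t) ->
  res hT (mor_sharp i V s) = res hT' (mor_sharp i W t).
Proof.
have k : opreim (mor_cont i) (opensI V W) `<=` opreim (mor_cont i) V by move=> y [].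
have k' : opreim (mor_cont i) (opensI V W) `<=` opreim (mor_cont i) W by move=> y [].
rewrite -(mor_res h k) -(mor_res h' k'); apply: res_eq_sub => y Ty.
by split; [exact: hT|exact: hT'].
Qed.

Hypothesis i_closed : closed_immersion i.

Lemma closed_immersion_opens (U : opens Y) :
  exists V : opens X, U = opreim (mor_cont i) V.
Proof. by case: i_closed => _ _ /(_ U)[V /opens_eq UV] _; exists V. Qed.

Variables (U : opens X) (A : comPzRingType).
Variables (phi : spec A -> X) (theta : {rmorphism A -> sec U}).
Hypothesis chart : affine_chart phi theta.

(** This is the quasi-coherence of the kernel of O_X -> i_* O_Y.  Locally on Y it
is [chart_annihilate].  A single exponent exists because the
part of Y over U is quasi-compact; the proof uses this as follows.  The h for
which some f ^+ n * b is in the kernel over D(h) form an ideal J; the local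
statement says that no prime contains J, so J contains 1. *)
Lemma sharp_ker_extend f (b : sec U) :
  mor_sharp i _ (res (@chart_basic_sub _ _ _ _ _ chart f) b) = 0 ->
  exists n, mor_sharp i U (theta f ^+ n * b) = 0.
Proof.
move=> bf0; set D := chart_basic chart; set sub := @chart_basic_sub _ _ _ _ _ chart.
pose J : set A := [set h | exists n,
  mor_sharp i (D h) (res (sub h) (theta f ^+ n * b)) = 0].
have Jle h n m : (n <= m)%N ->
    mor_sharp i (D h) (res (sub h) (theta f ^+ n * b)) = 0 ->
    mor_sharp i (D h) (res (sub h) (theta f ^+ m * b)) = 0.
  move=> nm E; rewrite -(subnK nm) exprD -mulrA.
  by rewrite [res _ _]rmorphM [mor_sharp _ _ _]rmorphM E mulr0.
have idJ : is_ideal J.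
  split.
  - exists 0%N; apply: sharp_ker_local => y Dy.
    have [P yP] := chart_pt chart (sub _ _ Dy); rewrite yP in Dy.
    by case: ((chart_basicP chart 0 P).1 Dy); exact: prime0 (spec_prime P).
  - move=> h1 h2 [n1 E1] [n2 E2]; exists (maxn n1 n2).
    apply: sharp_ker_local => y Dy.
    have [P yP] := chart_pt chart (sub _ _ Dy).
    have nP : ~ spec_ideal P (h1 + h2) by apply/(chart_basicP chart); rewrite -yP.
    suff [h [Jh nPh]] : exists h, mor_sharp i (D h)
        (res (sub h) (theta f ^+ maxn n1 n2 * b)) = 0 /\ ~ spec_ideal P h.
      exists (opensI (D (h1 + h2)) (D h)), (@opensI_subl _ _ _); split.
        by split=> //; rewrite yP; exact/chart_basicP.
      have hh : opensI (D (h1 + h2)) (D h) `<=` U by move=> z [_ /sub].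
      rewrite (res_comp _ _ hh) -(res_comp (sub h) (@opensI_subr _ _ _) hh).
      exact: sharp_ker_res.
    have [Ph1|nPh1] := pselect (spec_ideal P h1).
      exists h2; split; first by apply: Jle E2; rewrite leq_maxr.
      by move=> Ph2; apply: nP; exact: primeD (spec_prime P) _ _ _ _.
    by exists h1; split=> //; apply: Jle E1; rewrite leq_maxl.
  - move=> a h [n E]; exists n.
    have aD : D (a * h) `<=` D h.
      by rewrite !chart_basicE basic_openM; exact: image_subset.
    by rewrite -(res_comp (sub h) aD); exact: sharp_ker_res.
suff [n E] : J 1.
  exists n; apply: sharp_ker_local => y Uy; exists (D 1), (sub 1); split=> //.
  have [P ->] := chart_pt chart Uy; apply/chart_basicP; exact: prime1 (spec_prime P).
apply: contrapT => /(exists_prime idJ)[P JP].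
have Ux : opens_set U (phi P).
  by case: (chart) => _ _ _ rangeU _; rewrite -rangeU; exists P.
suff [g [/(chart_basicP chart) nPg Jg]] : exists g, opens_set (D g) (phi P) /\ J g.
  exact: nPg (JP _ Jg).
(* Over the open complement of the closed image of i, every section is in the
   kernel. *)
have [[y _ yx]|nx] := pselect (range i (phi P)); last first.
  have [_ cl _ _] := i_closed.
  have [g [gx gV]] := chart_basic_nbhs chart (V := Opens (closed_openC cl)) Ux nx.
  exists g; split=> //; exists 0%N; apply: sharp_ker_local => z /gV[].
  by exists z.
have [Uy Uyy [A' [psi [th chart']]]] := schemeP y.
have iUy : opens_set (opreim (mor_cont i) U) y by rewrite /= /preimage /= yx.
have [g' [g'y g'U]] := chart_basic_nbhs chart' Uyy iUy.
have [V' V'E] := closed_immersion_opens (chart_basic chart' g').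
have V'x : opens_set V' (phi P) by move: g'y; rewrite V'E /= /preimage /= yx.
have [g [gx gV']] := chart_basic_nbhs chart Ux V'x.
exists g; split=> //.
have [|n En] := chart_annihilate (chart := chart') (F := res g'U (mor_sharp i U (theta f)))
    (b := res g'U (mor_sharp i U b)).
  move=> V VW Vunit.
  (* By locality of i, V lies over D(f), where b is in the kernel. *)
  have Vf : V `<=` opreim (mor_cont i) (D f).
    move=> z Vz; have Wz := VW _ Vz.
    have /(unit_at_res g'U _ Wz) := Vunit z Vz.
    have Uz : opens_set U (i z) by exact: (g'U _ Wz).
    move=> /(mor_local Uz).
    have [Q zQ] := chart_pt chart Uz; rewrite zQ => /(chart_unit chart) Qf.
    by rewrite /= /preimage /= zQ; exact/chart_basicP.
  have hV : V `<=` opreim (mor_cont i) U by move=> z /VW/g'U.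
  have hf : opreim (mor_cont i) (D f) `<=` opreim (mor_cont i) U by move=> z /sub.
  rewrite (res_comp _ _ hV) -(res_comp hf Vf hV) (mor_res (sub f)).
  by rewrite bf0 rmorph0.
exists n.
have hg : opreim (mor_cont i) (D g) `<=` chart_basic chart' g'.
  by rewrite V'E => z /gV'.
have hgU : opreim (mor_cont i) (D g) `<=` opreim (mor_cont i) U.
  by move=> z /sub.
rewrite -(mor_res (sub g) hgU) -(res_comp g'U hg).
by rewrite rmorphM rmorphXn rmorphM rmorphXn En rmorph0.
Qed.

End Kernel.

(** Near a point of a chart, a section s over V times a power of f comes from an
element a of the chart; if s is in the kernel for i, then so is f ^+ m * a for
some m, by quasi-coherence.  That product is then in the kernel for j, and f is
invertible on D(f). *)
Lemma sharp_ker_affine_cover (Y Z X : scheme) (i : morphism Y X)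
    (j : morphism Z X) (T : Type) (U : T -> opens X) :
  closed_immersion i ->
  (forall x, exists a, opens_set (U a) x) -> (forall a, affine_open (U a)) ->
  (forall a (s : sec (U a)), mor_sharp i _ s = 0 -> mor_sharp j _ s = 0) ->
  forall (V : opens X) (s : sec V), mor_sharp i V s = 0 -> mor_sharp j V s = 0.
Proof.
move=> i_closed Ucov Uaff ijU V s s0; apply: sharp_ker_local => y Vy.
have [l Uy] := Ucov (j y); have [A [phi [theta chart]]] := Uaff l.
have [f [fy fV]] := chart_basic_nbhs chart Uy Vy.
exists (chart_basic chart f), fV; split=> //.
set sub := @chart_basic_sub _ _ _ _ _ chart f.
have [[e fe] surj _] := chart_loc chart f.
have [a [n aE]] := surj (res fV s).
have [|m am] := sharp_ker_extend i_closed (chart := chart) (f := f) (b := theta a).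
  by rewrite -aE rmorphM (sharp_ker_res fV s0) mul0r.
have /(sharp_ker_res sub) := ijU _ _ am.
rewrite [res _ _]rmorphM rmorphXn -aE.
move=> E.
have -> : res fV s = e ^+ (m + n) *
    (res sub (theta f) ^+ m * (res fV s * res sub (theta f) ^+ n)).
  transitivity ((res sub (theta f) * e) ^+ (m + n) * res fV s).
    by rewrite fe expr1n mul1r.
  by rewrite exprMn exprD; ring.
by rewrite rmorphM E mulr0.
Qed.

(** * Factorization through a closed immersion *)

Section Factor.
Variables (T Z X : scheme) (j : morphism T X) (i : morphism Z X).
Hypothesis i_closed : closed_immersion i.
Hypothesis ker_ij : forall (V : opens X) (s : sec V),
  mor_sharp i V s = 0 -> mor_sharp j V s = 0.

(** Over the complement V of the image of i, 1 is in the kernel for i, hence for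
j; so V has empty preimage under j. *)
Lemma factor_pt t : exists z, i z = j t.
Proof.
apply: contrapT => nz; have [_ cl _ _] := i_closed.
pose V := Opens (closed_openC cl).
have Vt : opens_set (opreim (mor_cont j) V) t by case=> z _ zt; apply: nz; exists z.
apply: (sec_neq0 Vt); rewrite -(rmorph1 (mor_sharp j V)); apply: ker_ij.
by apply: sec_empty => z; apply; exists z.
Qed.

Definition factor_fun t : Z := sval (cid (factor_pt t)).

Lemma factor_funE t : i (factor_fun t) = j t.
Proof. exact: svalP (cid (factor_pt t)). Qed.

Lemma factor_cont : continuous factor_fun.
Proof.
apply/continuousP => U oU.
have [V UV] := closed_immersion_opens i_closed (Opens oU).
suff -> : factor_fun @^-1` U = opreim (mor_cont j) V :> set T by exact: opens_open.
have {UV} -> : U = i @^-1` V by have := congr1 (@opens_set _) UV.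
by apply/seteqP; split=> t; rewrite /= /preimage /= factor_funE.
Qed.

Local Notation pull_i V := (opreim (mor_cont i) V).
Local Notation pull_j V := (opreim (mor_cont j) V).
Local Notation pull_h V := (opreim factor_cont V).

Lemma pull_factor (V : opens Z) (W : opens X) :
  pull_i W `<=` V -> pull_j W `<=` pull_h V.
Proof. by move=> WV t Wt; apply: WV; rewrite /= /preimage /= factor_funE. Qed.

(** The graph of the comorphism O_Z -> h_* O_T to be constructed: where s is the
pullback of a section u of O_X, its image is the pullback of u along j. *)
Definition sharp_graph (V : opens Z) (s : sec V) (r : sec (pull_h V)) : Prop :=
  forall t, opens_set (pull_h V) t ->
  exists (W : opens X) (WV : pull_i W `<=` V) (u : sec W),
    [/\ opens_set W (j t), res WV s = mor_sharp i W u
      & res (pull_factor WV) r = mor_sharp j W u].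

Lemma local_lift (V : opens Z) (s : sec V) z : opens_set V z ->
  exists (W : opens X) (WV : pull_i W `<=` V) (u : sec W),
    opens_set W (i z) /\ res WV s = mor_sharp i W u.
Proof.
have [V' VE] := closed_immersion_opens i_closed V; subst V.
move=> Vz; have [_ _ _ /(_ V' s (i z) Vz)[W [WV [h [u [Wz E]]]]]] := i_closed.
by exists W, h, u.
Qed.

(** Two local lifts u and u' of s differ by a section of the kernel for i, hence
of the kernel for j. *)
Lemma graph_overlap (V : opens Z) (s : sec V) (W W' : opens X)
    (WV : pull_i W `<=` V) (WV' : pull_i W' `<=` V) (u : sec W) (u' : sec W')
    (S : opens T) (hS : S `<=` pull_j W) (hS' : S `<=` pull_j W') :
  res WV s = mor_sharp i W u -> res WV' s = mor_sharp i W' u' ->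
  res hS (mor_sharp j W u) = res hS' (mor_sharp j W' u').
Proof.
move=> su su'.
apply: (@sharp_eq_res _ _ j W W' u u' (@opensI_subl X W W')
  (@opensI_subr X W W')).
apply/eqP; rewrite -subr_eq0 -rmorphB; apply/eqP; apply: ker_ij.
rewrite rmorphB; apply/eqP; rewrite subr_eq0; apply/eqP.
have k : pull_i (opensI W W') `<=` pull_i W by move=> z [].
have k' : pull_i (opensI W W') `<=` pull_i W' by move=> z [].
have k'' : pull_i (opensI W W') `<=` V by move=> z /k/WV.
by rewrite -(mor_res _ k) -(mor_res _ k') -su -su' !(res_comp _ _ k'').
Qed.

(** The pullbacks along j of all local lifts of s are glued. *)
Lemma sharp_graph_exists (V : opens Z) (s : sec V) : exists r, sharp_graph s r.
Proof.
pose I := {Wu : {W : opens X & sec W} |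
  exists WV : pull_i (projT1 Wu) `<=` V, res WV s = mor_sharp i _ (projT2 Wu)}.
pose W (a : I) : opens X := projT1 (sval a).
pose u (a : I) : sec (W a) := projT2 (sval a).
have WV a : pull_i (W a) `<=` V by case: a => [? []].
have su a : res (WV a) s = mor_sharp i _ (u a).
  by case: a (WV a) => [Wu [WV' E]] WV0; rewrite /u /=; rewrite -[RHS]E; exact: res_irr.
have lift t : opens_set (pull_h V) t -> exists a, opens_set (W a) (j t).
  move=> Vt; have [W0 [WV0 [u0 [Wt E]]]] := local_lift s Vt.
  by rewrite factor_funE in Wt; exists (exist _ (existT _ W0 u0) (ex_intro _ WV0 E)).
have [||r rP] := @sheaf_glue T I (fun a => pull_j (W a)) (pull_h V)
    (fun a => pull_factor (WV a)) _ (fun a => mor_sharp j _ (u a)).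
- by move=> t /lift[a Wt]; exists a.
- by move=> a b S Sa Sb; exact: (graph_overlap _ _ (su a) (su b)).
exists r => t /lift[a Wt]; exists (W a), (WV a), (u a); split=> //.
Qed.

Lemma sharp_graph_unique (V : opens Z) (s : sec V) r r' :
  sharp_graph s r -> sharp_graph s r' -> r = r'.
Proof.
move=> rP rP'; apply: sec_local_eq => t Vt.
have [W [WV [u [Wt su ru]]]] := rP t Vt.
have [W' [WV' [u' [Wt' su' ru']]]] := rP' t Vt.
have hV : pull_j (opensI W W') `<=` pull_h V.
  by move=> y [Wy _]; exact: (pull_factor WV).
exists (pull_j (opensI W W')), hV; split=> //.
have k : pull_j (opensI W W') `<=` pull_j W by move=> y [].
have k' : pull_j (opensI W W') `<=` pull_j W' by move=> y [].
rewrite -(res_comp (pull_factor WV) k) -(res_comp (pull_factor WV') k') ru ru'.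
exact: (graph_overlap _ _ su su').
Qed.

Definition factor_sharp (V : opens Z) (s : sec V) : sec (pull_h V) :=
  sval (cid (sharp_graph_exists s)).

Lemma factor_sharpP (V : opens Z) (s : sec V) : sharp_graph s (factor_sharp s).
Proof. exact: svalP (cid (sharp_graph_exists s)). Qed.

Lemma factor_sharp_eq (V : opens Z) (s : sec V) r :
  sharp_graph s r -> factor_sharp s = r.
Proof. exact: sharp_graph_unique (factor_sharpP s). Qed.

(** Two sections can be lifted over a common open, which makes the graph
compatible with the ring operations. *)
Lemma sharp_graph_common (V : opens Z) (s s' : sec V) r r' t :
  sharp_graph s r -> sharp_graph s' r' -> opens_set (pull_h V) t ->
  exists (W : opens X) (WV : pull_i W `<=` V) (u u' : sec W),
    [/\ opens_set W (j t), res WV s = mor_sharp i W u,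
        res WV s' = mor_sharp i W u', res (pull_factor WV) r = mor_sharp j W u
      & res (pull_factor WV) r' = mor_sharp j W u'].
Proof.
move=> rP rP' Vt.
have [W [WV [u [Wt su ru]]]] := rP t Vt.
have [W' [WV' [u' [Wt' su' ru']]]] := rP' t Vt.
have ki : pull_i (opensI W W') `<=` pull_i W by move=> y [].
have ki' : pull_i (opensI W W') `<=` pull_i W' by move=> y [].
have kj : pull_j (opensI W W') `<=` pull_j W by move=> y [].
have kj' : pull_j (opensI W W') `<=` pull_j W' by move=> y [].
have hV : pull_i (opensI W W') `<=` V by move=> y /ki/WV.
exists (opensI W W'), hV, (res (@opensI_subl _ _ _) u), (res (@opensI_subr _ _ _) u').
split=> //.
- by rewrite -(mor_res _ ki) -su (res_comp _ _ hV).
- by rewrite -(mor_res _ ki') -su' (res_comp _ _ hV).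
- by rewrite -(mor_res _ kj) -ru (res_comp _ _ (pull_factor hV)).
- by rewrite -(mor_res _ kj') -ru' (res_comp _ _ (pull_factor hV)).
Qed.

Lemma factor_sharpB (V : opens Z) : zmod_morphism (@factor_sharp V).
Proof.
move=> s s'; apply: factor_sharp_eq => t Vt.
have [W [WV [u [u' [Wt su su' ru ru']]]]] :=
  sharp_graph_common (factor_sharpP s) (factor_sharpP s') Vt.
by exists W, WV, (u - u'); split; rewrite // !rmorphB ?su ?su' ?ru ?ru'.
Qed.

Lemma factor_sharpM (V : opens Z) : monoid_morphism (@factor_sharp V).
Proof.
split=> [|s s']; apply: factor_sharp_eq => t Vt.
  have [W [WV [u [Wt su ru]]]] := factor_sharpP (1 : sec V) Vt.
  by exists W, WV, 1; split=> //; rewrite !rmorph1.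
have [W [WV [u [u' [Wt su su' ru ru']]]]] :=
  sharp_graph_common (factor_sharpP s) (factor_sharpP s') Vt.
by exists W, WV, (u * u'); split; rewrite // !rmorphM ?su ?su' ?ru ?ru'.
Qed.

HB.instance Definition _ (V : opens Z) :=
  GRing.isZmodMorphism.Build (sec V) (sec (pull_h V)) (@factor_sharp V)
    (@factor_sharpB V).
HB.instance Definition _ (V : opens Z) :=
  GRing.isMonoidMorphism.Build (sec V) (sec (pull_h V)) (@factor_sharp V)
    (@factor_sharpM V).

Lemma factor_res (V W : opens Z) (h : W `<=` V) (h' : pull_h W `<=` pull_h V)
    (s : sec V) :
  res h' (factor_sharp s) = factor_sharp (res h s).
Proof.
apply/esym/factor_sharp_eq => t Wt.
have [D [DV [u [Dt su ru]]]] := factor_sharpP s (h' _ Wt).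
have [W' W'E] := closed_immersion_opens i_closed W.
have ki : pull_i (opensI D W') `<=` pull_i D by move=> y [].
have kj : pull_j (opensI D W') `<=` pull_j D by move=> y [].
have hW : pull_i (opensI D W') `<=` W by rewrite W'E => y [].
have hV : pull_i (opensI D W') `<=` V by move=> y /hW/h.
exists (opensI D W'), hW, (res (@opensI_subl _ _ _) u); split.
- by split=> //; move: Wt; rewrite W'E /= /preimage /= factor_funE.
- by rewrite -(mor_res _ ki) -su !(res_comp _ _ hV).
- by rewrite -(mor_res _ kj) -ru !(res_comp _ _ (pull_factor hV)).
Qed.

Lemma unit_at_sharp (Y : scheme) (f : morphism Y X) (V : opens X) (s : sec V) y :
  unit_at s (f y) -> unit_at (mor_sharp f V s) y.
Proof.
move=> [W [WV [Wy [r sr]]]].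
have h : opreim (mor_cont f) W `<=` opreim (mor_cont f) V by move=> z /WV.
exists (opreim (mor_cont f) W), h; split=> //; exists (mor_sharp f W r).
by rewrite (mor_res WV) -rmorphM sr rmorph1.
Qed.

Lemma factor_local (V : opens Z) (s : sec V) (t : T) :
  opens_set V (factor_fun t) -> unit_at (factor_sharp s) t ->
  unit_at s (factor_fun t).
Proof.
move=> Vt; have [W [WV [u [Wt su ru]]]] := factor_sharpP s Vt.
have Wt' : opens_set (pull_i W) (factor_fun t).
  by rewrite /= /preimage /= factor_funE.
move=> /(unit_at_res (pull_factor WV) _ Wt).1.
rewrite ru => /(mor_local Wt); rewrite -factor_funE => /unit_at_sharp.
by rewrite -su => /(unit_at_res WV _ Wt').
Qed.

(** The universal property of a closed immersion i: the morphisms whose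
comorphism kills the kernel for i factor through i. *)
Lemma closed_immersion_factor : exists h : morphism T Z, mor_eq (comp_mor i h) j.
Proof.
exists (@Morphism T Z factor_fun factor_cont
  (fun V => [the {rmorphism _ -> _} of @factor_sharp V]) factor_res factor_local).
split=> [t|V S Sh Sj s]; first exact: factor_funE.
rewrite /= /comp_sharp /=.
have WV : pull_i V `<=` pull_i V by [].
have WVj : pull_j V `<=` pull_j V by [].
have h : pull_h (pull_i V) `<=` pull_j V.
  by move=> t; rewrite /= /preimage /= factor_funE.
have rj : res (pull_factor WV) (res h (mor_sharp j V s)) = mor_sharp j V s.
  by rewrite (res_comp _ _ WVj) res_id.
rewrite (@factor_sharp_eq _ _ (res h (mor_sharp j V s))).
  have Sh' : S `<=` pull_h (pull_i V) by [].
  transitivity (res Sh' (res h (mor_sharp j V s))); exact: res_comp.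
by move=> t Vt; exists V, WV, s; split=> //; [exact: (h t)|exact: res_id].
Qed.

End Factor.

(** * Closed subschemes and their ideal sheaves *)

Lemma comp_sharpE (X Y Z : scheme) (g : morphism Y Z) (f : morphism X Y)
    (V : opens Z) (S : opens X)
    (h : S `<=` opreim (mor_cont (comp_mor g f)) V)
    (h' : S `<=` opreim (mor_cont f) (opreim (mor_cont g) V)) (s : sec V) :
  res h (mor_sharp (comp_mor g f) V s) = res h' (mor_sharp f _ (mor_sharp g V s)).
Proof. exact: res_comp. Qed.

(** A closed immersion is a monomorphism: it is injective on points, and every
section of O_Z is locally pulled back from X. *)
Lemma closed_immersion_mono (T Z X : scheme) (i : morphism Z X)
    (f g : morphism T Z) :
  closed_immersion i -> mor_eq (comp_mor i f) (comp_mor i g) -> mor_eq f g.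
Proof.
move=> i_closed [fg_pt fg_sec]; have [i_inj _ _ _] := i_closed.
have fg t : f t = g t by apply: i_inj; exact: fg_pt.
split=> // V S Sf Sg s; apply: sec_local_eq => t St.
have [W [WV [u [Wt su]]]] := local_lift i_closed s (Sf _ St).
pose D := opreim (mor_cont f) (opreim (mor_cont i) W).
pose D' := opreim (mor_cont g) (opreim (mor_cont i) W).
exists (opensI S D), (@opensI_subl _ _ _); split=> //.
have kf : opensI S D `<=` opreim (mor_cont f) V by move=> y [/Sf].
have kg : opensI S D `<=` opreim (mor_cont g) V by move=> y [/Sg].
have Df : opensI S D `<=` D by move=> y [].
have Dg : opensI S D `<=` D' by move=> y []; rewrite /D /D' /= /preimage /= fg.
have DV : D `<=` opreim (mor_cont f) V by move=> y /WV.
have DV' : D' `<=` opreim (mor_cont g) V by move=> y /WV.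
rewrite (res_comp _ _ kf) (res_comp _ _ kg) -(res_comp DV Df) -(res_comp DV' Dg).
rewrite (mor_res WV) (mor_res WV) su.
by have := fg_sec W (opensI S D) Df Dg u; rewrite (comp_sharpE _ Df) (comp_sharpE _ Dg).
Qed.

Lemma mor_eq_compA (T Y Z X : scheme) (i : morphism Y X) (g : morphism Z Y)
    (j : morphism Z X) (h : morphism T Z) (l : morphism T X) :
  mor_eq (comp_mor i g) j -> mor_eq (comp_mor j h) l ->
  mor_eq (comp_mor i (comp_mor g h)) (comp_mor l (id_mor T)).
Proof.
move=> [ig_pt ig_sec] [jh_pt jh_sec]; split=> [t|V S S1 S2 s].
  by rewrite /= -jh_pt /= -ig_pt.
pose D := opreim (mor_cont g) (opreim (mor_cont i) V).
have Dj : D `<=` opreim (mor_cont j) V.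
  by move=> z; rewrite /D /= /preimage /= -ig_pt.
have DD : D `<=` D by [].
have igE : mor_sharp g _ (mor_sharp i V s) = res Dj (mor_sharp j V s).
  by rewrite -(ig_sec V D DD Dj s) (comp_sharpE _ DD) res_id.
have k1 : S `<=` opreim (mor_cont h) D by [].
have k2 : S `<=` opreim (mor_cont l) V by [].
have k3 : opreim (mor_cont h) D `<=` opreim (mor_cont h) (opreim (mor_cont j) V).
  by move=> t /Dj.
have k4 : S `<=` opreim (mor_cont h) (opreim (mor_cont j) V) by move=> t /k1/k3.
transitivity (res k1 (mor_sharp h D (mor_sharp g _ (mor_sharp i V s)))).
  rewrite (comp_sharpE _ (k1 : S `<=` opreim (mor_cont (comp_mor g h)) _)).
  exact: (comp_sharpE (g := g)).
transitivity (res k2 (mor_sharp l V s)); last first.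
  have k2' : S `<=` opreim (@id_cont T) (opreim (mor_cont l) V) by [].
  apply/esym; transitivity (res k2' (id_sharp _ (mor_sharp l V s))).
    exact: (comp_sharpE (f := id_mor T)).
  exact: res_comp.
rewrite igE -(mor_res _ k3) (res_comp _ _ k4).
by rewrite -(jh_sec V S k4 k2 s) (comp_sharpE _ k4).
Qed.

(** Equal kernels give morphisms over X in both directions, which are mutually
inverse since the closed immersions into X are monomorphisms. *)
Lemma ideal_sheaf_inj (X : scheme) (Y Z : closed_subscheme X) :
  (forall (V : opens X) (s : sec V), ideal_sheaf Y s <-> ideal_sheaf Z s) ->
  same_subscheme Y Z.
Proof.
move=> YZ.
have [h hE] := closed_immersion_factor (sub_closed Z) (fun V s => (YZ V s).2).
have [g gE] := closed_immersion_factor (sub_closed Y) (fun V s => (YZ V s).1).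
exists h, g; split=> //.
  by apply: (closed_immersion_mono (sub_closed Y)); exact: mor_eq_compA hE.
by apply: (closed_immersion_mono (sub_closed Z)); exact: mor_eq_compA gE.
Qed.

(** * Finiteness *)

Lemma finite_representatives (T : Type) (F : finType) (P : T -> Prop)
    (E : T -> T -> Prop) (code : T -> F) :
  (forall x y, P x -> P y -> code x = code y -> E x y) ->
  exists (n : nat) (Z : 'I_n -> T),
    (forall i, P (Z i)) /\ forall x, P x -> exists i, E x (Z i).
Proof.
move=> codeE; pose S := [set a : F | `[< exists x, P x /\ code x = a >]]%SET.
have ex (i : 'I_#|S|) : exists x, P x /\ code x = enum_val i.
  by apply/asboolP; have := enum_valP i; rewrite inE.
have [Z ZP] := choice ex.
exists #|S|, Z; split=> [i|x Px]; first exact: (ZP i).1.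
have Sx : code x \in S by rewrite inE; apply/asboolP; exists x.
exists (enum_rank_in Sx (code x)); apply: codeE => //; first exact: (ZP _).1.
by rewrite (ZP _).2 enum_rankK_in.
Qed.

Lemma closed_field_rootn (k : closedFieldType) (n : nat) (t : k) :
  (0 < n)%N -> exists s, s ^+ n = t.
Proof.
move=> n0; have [s sE] := solve_monicpoly (fun i => if i == 0%N then t else 0) n0.
exists s; rewrite sE; case: n n0 {sE} => // n _.
by rewrite big_ord_recl /= expr0 mulr1 big1 ?addr0 // => i _; rewrite mul0r.
Qed.

Theorem theorem1p1 (k : closedFieldType) (p : nat) (char_p : p \in [pchar k])
    (X : schemeOver k) (X_sep : is_separated X) (X_ft : of_finite_type X)
    (sigma : frobenius_hom p X) (sigma_split : is_splitting sigma) :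
  exists (n : nat) (Z : 'I_n -> closed_subscheme X),
    (forall i, compatibly_split sigma (Z i)) /\
    forall Y : closed_subscheme X, compatibly_split sigma Y ->
      exists i, same_subscheme Y (Z i).
Proof.
have p_gt1 : (1 < p)%N by exact: prime_gt1 (pcharf_prime char_p).
have [n [U [Ucov Uft]]] := X_ft.
have finU i : finite_set (stable_ideal (sigma (U i))).
  have [_ fgU] := Uft i; pose UX : U i `<=` opensT X := fun _ _ => I.
  pose c : {rmorphism k -> sec (U i)} := res UX \o over_str X.
  apply: (finite_stable_ideals_fg (c := c) p_gt1 _ (@frob_lin _ _ sigma (U i))
    (sigma_split (U i))); last exact: fgU.
  by move=> t; apply: closed_field_rootn; exact: ltnW.
have lex i : exists l : seq (set (sec (U i))),
    stable_ideal (sigma (U i)) = [set` l].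
  by have /finite_seqP := finU i.
pose l i := sval (cid (lex i)).
have lP i : stable_ideal (sigma (U i)) = [set` l i] := svalP (cid (lex i)).
(* A compatibly split Y is encoded by the positions of its ideals in the lists
   [l i]. *)
pose pos (Y : closed_subscheme X) i := index (@ideal_sheaf _ Y (U i)) (l i).
have pos_lt Y i : compatibly_split sigma Y -> (pos Y i < size (l i))%N.
  move=> splitY; rewrite index_mem.
  suff : stable_ideal (sigma (U i)) (@ideal_sheaf _ Y (U i)) by rewrite lP.
  split; last exact: splitY.
  rewrite /ideal_sheaf; split=> /= [|f g f0 g0|f g g0]; first exact: rmorph0.
    by rewrite rmorphD f0 g0 addr0.
  by rewrite rmorphM g0 mulr0.
pose m := \max_i size (l i).
apply: (@finite_representatives _ {ffun 'I_n -> 'I_m.+1} _ _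
  (fun Y => [ffun i => inord (pos Y i)])) => Y Z splitY splitZ /ffunP codeYZ.
have YZ i : @ideal_sheaf _ Y (U i) = @ideal_sheaf _ Z (U i).
  have lt W : compatibly_split sigma W -> (pos W i < m.+1)%N.
    by move=> /(pos_lt W i)/ltnW posW; rewrite ltnS (leq_trans posW) ?leq_bigmax.
  have := congr1 (@nat_of_ord _) (codeYZ i); rewrite !ffunE !inordK ?lt // => posYZ.
  rewrite -(nth_index set0 (_ : @ideal_sheaf _ Y (U i) \in l i)); last first.
    by rewrite -index_mem pos_lt.
  by rewrite -/(pos Y i) posYZ nth_index // -index_mem pos_lt.
apply: ideal_sheaf_inj => V s.
by split; [have cl := sub_closed Y|have cl := sub_closed Z];
  apply: (sharp_ker_affine_cover cl Ucov (fun i => (Uft i).1)) => i r;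
  have := congr1 (fun I => I r) (YZ i); rewrite /ideal_sheaf /= => ->.
Qed.
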